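(* Let $K=(K[0],\dots,K[256])\in\{0,1\}^{257}$ be the key current at any step of the HCA model, and let $\phi_m,\phi_b:\{0,1\}^9\to\{0,1\}$ be the main rule and the border rule derived from $K$. Let $B\subset\mathbb{Z}/128\mathbb{Z}$ be the border region at that step, a set of $8$ cyclically consecutive positions, and let $\Phi=\Phi_{\phi_m,\phi_b,B}:\{0,1\}^{128}\to\{0,1\}^{128}$ be the corresponding one-step forward evolution of the hybrid cellular automaton on the periodic lattice of $128$ cells. Then every configuration $s^{t}\in\{0,1\}^{128}$ has one and only one pre-image, i.e. there exists exactly one $s^{t-1}\in\{0,1\}^{128}$ such that $\Phi(s^{t-1})=s^{t}$.
   Context: **Lattice.** A configuration is a binary string $s=(s[0],\dots,s[127])\in\{0,1\}^{128}$. Indices are taken modulo $128$ (periodic boundary). **Radius-4 rules.** A radius-4 rule is a map $\phi:\{0,1\}^9\to\{0,1\}$. It is encoded as a 512-bit string $\phi[0],\dots,\phi[511]$, where $\phi(x_{-4},x_{-3},\dots,x_{4})=\phi[j]$ and $j\in\{0,\dots,511\}$ is the integer with binary expansion $x_{-4}x_{-3}\cdots x_4$ ($x_{-4}$ most significant). Write $\overline{b}=1-b$ for $b\in\{0,1\}$. **Main rule derived from a key $K\in\{0,1\}^{257}$.** The first 256 bits of $K$ determine the rule values, and the last bit $K[256]$ determines the toggle direction ($0$: left, $1$: right). - If $K[256]=0$: $\phi_m[j]=K[j]$ and $\phi_m[256+j]=\overline{K[j]}$ for $0\le j\le 255$. - If $K[256]=1$: $\phi_m[2j]=K[j]$ and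 $\phi_m[2j+1]=\overline{K[j]}$ for $0\le j\le 255$. **Border rule derived from $K$.** It has the same toggle direction as $\phi_m$, and its first bit is the complement of the first bit of $\phi_m$. As 512-bit strings: - $K[256]=0$, $\phi_m[0]=0$: $\phi_b=1^{256}0^{256}$ (256 ones followed by 256 zeros). - $K[256]=0$, $\phi_m[0]=1$: $\phi_b=0^{256}1^{256}$. - $K[256]=1$, $\phi_m[0]=0$: $\phi_b=1010\cdots10$. - $K[256]=1$, $\phi_m[0]=1$: $\phi_b=0101\cdots01$. **Forward evolution.** Given $\phi_m,\phi_b$ and the border region $B=\{c,c+1,\dots,c+7\}\subset\mathbb{Z}/128\mathbb{Z}$ for some $c\in\mathbb{Z}/128\mathbb{Z}$, the map $\Phi:\{0,1\}^{128}\to\{0,1\}^{128}$ is $$\Phi(s)[i]=\begin{cases}\phi_b(s[i-4],s[i-3],\dots,s[i+4]) & i\in B,\\ \phi_m(s[i-4],s[i-3],\dots,s[i+4]) & i\notin B,\end{cases}$$ with indices modulo $128$. (In the lattice coordinates used by the algorithm, $c=0$, so $B=\{0,\dots,7\}$. Between steps the lattice is circularly shifted by 8 positions, so relative to the original cells the border moves from step to step.) A pre-image of $s$ is any configuration $s'$ with $\Phi(s')=s$. *)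

(* Defs.v *)
From mathcomp Require Import all_boot all_order all_algebra.

Set Implicit Arguments.
Unset Strict Implicit.
Unset Printing Implicit Defensive.

Import GRing.Theory.

(* The bit [j] of a bit string; only used with [j] within bounds. *)
Definition bit n (w : n.-tuple bool) (j : nat) : bool := nth false w j.

Definition key := 257.-tuple bool.

Definition rule_string := 512.-tuple bool.

(* The integer with binary expansion x_{-4} ... x_4, where component [k] of
   [x] holds x_{k-4}. *)
Definition neighborhood_code (x : 9.-tuple bool) : nat :=
  \sum_(k < 9) tnth x k * 2 ^ (8 - k).

Definition rule_of_string (w : rule_string) (x : 9.-tuple bool) : bool :=
  bit w (neighborhood_code x).

(* [bit K 256] is the toggle direction: [false] is left, [true] is right. *)
Definition main_string (K : key) : rule_string :=
  if bit K 256 then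
    [tuple (if odd j then ~~ bit K j./2 else bit K j./2) | j < 512]
  else
    [tuple (if j < 256 then bit K j else ~~ bit K (j - 256)) | j < 512].

(* In order: 1^256 0^256, 0^256 1^256, 1010...10 and 0101...01. *)
Definition border_string (K : key) : rule_string :=
  match bit K 256, bit (main_string K) 0 with
  | false, false => [tuple (j < 256) | j < 512]
  | false, true => [tuple (256 <= j) | j < 512]
  | true, false => [tuple ~~ odd j | j < 512]
  | true, true => [tuple odd j | j < 512]
  end.

Definition main_rule (K : key) : 9.-tuple bool -> bool :=
  rule_of_string (main_string K).

Definition border_rule (K : key) : 9.-tuple bool -> bool :=
  rule_of_string (border_string K).

Definition configuration := {ffun 'Z_128 -> bool}.

Definition neighborhood (s : configuration) (i : 'Z_128) : 9.-tuple bool :=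
  [tuple s (i - 4%:R + k%:R)%R | k < 9].

Definition is_border_region (B : {set 'Z_128}) : Prop :=
  exists c : 'Z_128, B = [set (c + k%:R)%R | k : 'I_8].

Definition evolution (phi_m phi_b : 9.-tuple bool -> bool) (B : {set 'Z_128})
    (s : configuration) : configuration :=
  [ffun i => if i \in B then phi_b (neighborhood s i)
             else phi_m (neighborhood s i)].

(* Main.v *)
(** The toggle bit makes each rule an exclusive or of its outermost input on the
    toggle side with a function of the eight others, and for the border rule that
    function is constant.  Hence the image of a configuration on the border reveals
    eight consecutive cells, after which each further cell in the toggle direction
    is determined by the eight cells before it.  So the evolution is injective, and
    bijective by finiteness. *)
Require Import Defs.
From mathcomp Require Import all_boot all_order all_algebra.
From mathcomp Require Import zify ring.

Import GRing.Theory.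

(** Permutivity in the input [p], since an injective map on [bool] is bijective. *)
Definition toggles_at (p : 'I_9) (f : 9.-tuple bool -> bool) :=
  forall x y, (forall k, k != p -> tnth x k = tnth y k) ->
  f x = f y -> tnth x p = tnth y p.

Definition reveals (p : 'I_9) (f : 9.-tuple bool -> bool) :=
  forall x y, f x = f y -> tnth x p = tnth y p.

(** For a left toggle, the position in the key of the bit that the main rule adds to its leftmost
    input; [right_rest] is the analogue for a right toggle. *)
Definition left_rest (x : 9.-tuple bool) : nat :=
  \sum_(k < 8) tnth x (lift ord0 k) * 2 ^ (7 - k).

Definition right_rest (x : 9.-tuple bool) : nat :=
  \sum_(k < 8) tnth x (widen_ord (leqnSn 8) k) * 2 ^ (7 - k).

Lemma binary8_lt (b : 'I_8 -> bool) : \sum_(k < 8) b k * 2 ^ (7 - k) < 256.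
Proof.
apply: (@leq_ltn_trans (\sum_(k < 8) 2 ^ (7 - k))).
  by apply: leq_sum => k _; case: (b k); rewrite ?mul1n.
by rewrite !big_ord_recr big_ord0.
Qed.

Lemma neighborhood_code_left x :
  neighborhood_code x = tnth x ord0 * 256 + left_rest x.
Proof. by rewrite /neighborhood_code big_ord_recl. Qed.

Lemma neighborhood_code_right x :
  neighborhood_code x = right_rest x * 2 + tnth x ord_max.
Proof.
rewrite /neighborhood_code big_ord_recr /= muln1 big_distrl; congr (_ + _).
apply: eq_bigr => k _ /=; rewrite -mulnA -expnSr; congr (_ * 2 ^ _).
by have := ltn_ord k; lia.
Qed.

Lemma bit_mktuple n (f : 'I_n -> bool) j (ltjn : j < n) :
  bit (mktuple f) j = f (Ordinal ltjn).
Proof. by rewrite /bit -(tnth_nth _ _ (Ordinal ltjn)) tnth_mktuple. Qed.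

Lemma main_string_left K (b : bool) r : bit K 256 = false -> r < 256 ->
  bit (main_string K) (b * 256 + r) = b (+) bit K r.
Proof.
move=> KL lt_r; have lt_j : b * 256 + r < 512 by case: b; lia.
rewrite /main_string KL bit_mktuple /=; case: b {lt_j}; last by rewrite lt_r.
by rewrite mul1n addKn ltnNge leq_addr.
Qed.

Lemma main_string_right K (b : bool) r : bit K 256 -> r < 256 ->
  bit (main_string K) (r * 2 + b) = b (+) bit K r.
Proof.
move=> KR lt_r; have lt_j : r * 2 + b < 512 by case: b; lia.
rewrite /main_string KR bit_mktuple /= muln2 addnC oddD odd_double.
by rewrite half_bit_double; case: b {lt_j}.
Qed.

(** Each half of the string is constant, so [r] drops out; the constant is the value at code 0,
    opposite to that of the main rule. *)
Lemma border_string_left K (b : bool) r : bit K 256 = false -> r < 256 ->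
  bit (border_string K) (b * 256 + r) = b (+) ~~ bit (main_string K) 0.
Proof.
move=> KL lt_r; have lt_j : b * 256 + r < 512 by case: b; lia.
by rewrite /border_string KL; case: (bit (main_string K) 0);
  rewrite bit_mktuple /=; case: b {lt_j} => /=; lia.
Qed.

Lemma border_string_right K (b : bool) r : bit K 256 -> r < 256 ->
  bit (border_string K) (r * 2 + b) = b (+) ~~ bit (main_string K) 0.
Proof.
move=> KR lt_r; have lt_j : r * 2 + b < 512 by case: b; lia.
rewrite /border_string KR; case: (bit (main_string K) 0);
  by rewrite bit_mktuple /= muln2 oddD odd_double; case: b {lt_j}.
Qed.

Definition toggle_position (K : key) : 'I_9 :=
  if bit K 256 then ord_max else ord0.

Lemma main_rule_toggles K : toggles_at (toggle_position K) (main_rule K).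
Proof.
rewrite /toggle_position /main_rule /rule_of_string => x y.
case: ifP => [KR | KL] eq_xy.
  rewrite !neighborhood_code_right !main_string_right ?binary8_lt //.
  have -> : right_rest x = right_rest y.
    apply: eq_bigr => k _; rewrite eq_xy //.
    by rewrite -val_eqE /= neq_ltn ltn_ord.
  exact: addIb.
rewrite !neighborhood_code_left !main_string_left ?binary8_lt //.
have -> : left_rest x = left_rest y by apply: eq_bigr => k _; rewrite eq_xy.
exact: addIb.
Qed.

Lemma border_rule_reveals K : reveals (toggle_position K) (border_rule K).
Proof.
rewrite /toggle_position /border_rule /rule_of_string => x y.
case: ifP => [KR | KL].
  rewrite !neighborhood_code_right !border_string_right ?binary8_lt //.
  exact: addIb.
rewrite !neighborhood_code_left !border_string_left ?binary8_lt //.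
exact: addIb.
Qed.

(* [cell] is the order in which the equations at the cells of the lattice are
   solved, each for its neighbor at offset [p - 4]. *)
Lemma evolution_inj phi_m phi_b (B : {set 'Z_128}) (p : 'I_9)
    (cell : nat -> 'Z_128) :
  toggles_at p phi_m -> reveals p phi_b ->
  (forall n, n < 8 -> cell n \in B) ->
  (forall j, exists n, j = (cell n - 4%:R + p%:R)%R) ->
  (forall n (k : 'I_9), 8 <= n -> k != p ->
     exists2 m, m < n & (cell n - 4%:R + k%:R = cell m - 4%:R + p%:R)%R) ->
  injective (evolution phi_m phi_b B).
Proof.
move=> phi_mP phi_bP cellB cell_onto cell_prev s1 s2 /ffunP eq_s.
apply/ffunP => j; have [n ->] := cell_onto j.
(* The induction is on the solving order, a natural number, so the cyclic lattice causes no
   circularity. *)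
elim/ltn_ind: n => n IHn; have := eq_s (cell n); rewrite !ffunE.
have tnthN s k : tnth (neighborhood s (cell n)) k
    = s (cell n - 4%:R + k%:R)%R by rewrite tnth_mktuple.
rewrite -!tnthN; case: ifPn => [_ /phi_bP // | notB].
apply: phi_mP => k neq_kp; rewrite !tnthN.
have le8n : 8 <= n by rewrite leqNgt; apply: contra notB; apply: cellB.
by have [m lt_mn ->] := cell_prev n k le8n neq_kp; apply: IHn.
Qed.

Theorem theorem1 (K : key) (B : {set 'Z_128}) (hB : is_border_region B)
    (s : configuration) :
  exists! s' : configuration,
    evolution (main_rule K) (border_rule K) B s' = s.
Proof.
have [c defB] := hB.
have inB r : r < 8 -> (c + r%:R)%R \in B.
  by move=> lt_r8; rewrite defB; apply/imsetP; exists (Ordinal lt_r8).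
suff Phi_inj : injective (evolution (main_rule K) (border_rule K) B).
  have [Psi PsiK PhiK] := injF_bij Phi_inj.
  by exists (Psi s); split=> [|s' <-]; [apply: PhiK | apply: PsiK].
have mainP := @main_rule_toggles K; have borderP := @border_rule_reveals K.
move: mainP borderP; rewrite /toggle_position; case: ifP => _ mainP borderP.
(* Right toggle: the sweep starts at the left end of [B] and moves right, the equation at [c + n]
   giving the cell [c + n + 4]. *)
- apply: (evolution_inj _ _ _ _ (fun n => c + n%:R)%R mainP borderP) => //.
  + move=> j; exists (j - c - 4%:R : 'Z_128)%R.
    by rewrite natr_Zp /=; ring.
  + move=> n k le8n neq_k; have lt_k : k < 8.
      by rewrite ltn_neqAle neq_k -ltnS ltn_ord.
    (* Solves [n - 4 + k = m + 4]; the truncated subtraction is exact because [8 - k <= 8 <= n]. *)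
    exists (n - (8 - k)); first by lia.
    by rewrite natrB ?natrB /=; [ring | lia..].
(* Left toggle: the sweep starts at the right end [c + 7] of [B] and moves left, step [n] giving the
   cell [c + 3 - n]. *)
- apply: (evolution_inj _ _ _ _ (fun n => c + 7%:R - n%:R)%R mainP borderP).
  + by move=> n lt_n8; rewrite -addrA -natrB //; apply: inB; lia.
  + move=> j; exists (c + 3%:R - j : 'Z_128)%R.
    by rewrite natr_Zp /=; ring.
  + move=> n k le8n neq_k; have lt0k : 0 < k by rewrite lt0n.
    (* Offset [k] points back to the cell found [k] steps earlier; [0 < k] makes that step strictly
       earlier. *)
    exists (n - k); first by lia.
    by rewrite natrB /=; [ring | have := ltn_ord k; lia].
Qed.
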